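(* Let $C\subset\mathbb{R}^d$ be a convex body that is lattice complete with respect to a $d$-dimensional lattice $\Lambda$, and let $k$ be the dimension of the linear span of the set of diameter directions $v\in\Lambda$ of $C$. Then $C$ is a polytope with at most $2^{k+1}-2$ facets.
   Context: A convex body is a compact convex set with non-empty interior. A lattice $\Lambda\subset\mathbb{R}^d$ is a discrete subgroup spanning $\mathbb{R}^d$. A segment $[a,b]$ is a lattice segment if $b-a$ is parallel to a nonzero vector of $\Lambda$; its lattice length is $|b-a|/|v|$ where $v$ generates $\Lambda\cap\mathrm{span}\{b-a\}$ and is a positive multiple of $b-a$. The lattice diameter $\mathrm{diam}_\Lambda(C)$ is the maximum lattice length of a lattice segment in $C$. A diameter direction of $C$ is a vector $v\in\Lambda\setminus\{0\}$ such that $C$ contains a segment $[a,a+\mathrm{diam}_\Lambda(C)\,v]$. $C$ is lattice complete if no convex body $C'\supsetneq C$ has $\mathrm{diam}_\Lambda(C')=\mathrm{diam}_\Lambda(C)$. *)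

(* Defs.v *)
From HB Require Import structures.
From mathcomp Require Import all_boot all_order all_algebra.
From mathcomp Require Import all_classical all_reals all_analysis.
Set Implicit Arguments. Unset Strict Implicit. Unset Printing Implicit Defensive.
Import Order.TTheory GRing.Theory Num.Theory.
Import numFieldNormedType.Exports.
Local Open Scope classical_set_scope.
Local Open Scope ring_scope.

Section LatticeDefs.
Variables (R : realType) (d : nat).
Local Notation V := 'rV[R]_d.

Definition dotv (u x : V) : R := (u *m x^T) 0 0.

Definition segment (a b : V) : set V :=
  [set x | exists t : R, 0 <= t <= 1 /\ x = a + t *: (b - a)].

Definition convex_set (C : set V) : Prop :=
  forall x y t, C x -> C y -> 0 <= t <= 1 -> C (x + t *: (y - x)).

Definition convex_body (C : set V) : Prop :=
  compact C /\ convex_set C /\ (interior C !=set0).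

Definition is_lattice (L : set V) : Prop :=
  [/\ L 0,
      (forall x y, L x -> L y -> L (x - y)),
      (exists2 e : R, 0 < e & forall v, L v -> v != 0 -> e <= `|v|) &
      (exists B : 'M[R]_d, (forall i, L (row i B)) /\ B \in unitmx)].

Definition primitive_in (L : set V) (v : V) : Prop :=
  L v /\ v != 0 /\ forall (w : V) (s : R), L w -> w = s *: v -> s \is a Num.int.

(* [a,b] is a lattice segment of lattice length t: b - a = t v with t >= 0
   and v a generator of L ∩ span{b-a} (so t = |b-a|/|v|). *)
Definition lattice_length (L : set V) (a b : V) (t : R) : Prop :=
  exists v, primitive_in L v /\ 0 <= t /\ b - a = t *: v.

(* lattice diameter: maximal lattice length of a lattice segment in C
   (taken as a supremum; it is attained for convex bodies) *)
Definition lattice_diam (L : set V) (C : set V) : R :=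
  sup [set t | exists a b, lattice_length L a b t /\ segment a b `<=` C].

Definition diameter_direction (L : set V) (C : set V) (v : V) : Prop :=
  L v /\ v != 0 /\ exists a, segment a (a + lattice_diam L C *: v) `<=` C.

Definition lattice_complete (L : set V) (C : set V) : Prop :=
  forall C', convex_body C' -> C `<=` C' -> C' <> C ->
    lattice_diam L C' <> lattice_diam L C.

Definition span_dim (S : set V) (k : nat) : Prop :=
  exists A : 'M[R]_(k, d),
    [/\ (forall i, S (row i A)), row_free A & forall v, S v -> (v <= A)%MS].

Definition is_polytope (C : set V) : Prop :=
  exists (n : nat) (p : 'I_n -> V),
    C = [set x | exists w : 'I_n -> R,
                 [/\ (forall i, 0 <= w i), \sum_i w i = 1 &
                     x = \sum_i w i *: p i]].

(* F is a facet of C: the intersection of C with a supporting hyperplane,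
   of affine dimension d-1 (contains d affinely independent points) *)
Definition facet (C F : set V) : Prop :=
  exists (u : V) (b : R),
    [/\ u != 0, (forall x, C x -> dotv u x <= b),
        F = [set x | C x /\ dotv u x = b] &
        exists P : 'M[R]_d, (forall i, F (row i P)) /\
          \rank (row_mx P (const_mx 1 : 'M[R]_(d, 1))) = d].

End LatticeDefs.

(* Main.v *)
Require Import Defs.
From HB Require Import structures.
From mathcomp Require Import all_boot all_order all_algebra.
From mathcomp Require Import all_classical all_reals all_analysis.
From mathcomp Require Import ring lra zify.
Import Order.TTheory GRing.Theory Num.Theory.
Import numFieldNormedType.Exports.
Local Open Scope classical_set_scope.
Local Open Scope ring_scope.

(* Write K = C - C and delta for the lattice diameter. A nonzero lattice vector v is
   a diameter direction iff delta v lies in K, and then it lies on the boundary of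
   K, so some linear form u attains its maximum over K at delta v; such a u bounds C
   by a slab whose two sides pass through the ends of a diameter in direction v.
   Suppose that every diameter direction attains, up to sign, the maximum of one of
   finitely many forms u, and let P be the intersection of their slabs. Then P
   allows no segment longer than delta in a diameter direction, while the remaining
   lattice directions stay short in a small neighbourhood of C; hence completeness
   forces C = P, and C has at most two facets per form.
   If v and w are diameter directions congruent modulo 2 L and v is not w or - w,
   then their midpoint is a diameter direction too, and every form which is maximal
   there is maximal at v and at w. So one form per nonzero class modulo 2 (L meet
   span) is enough, and there are at most 2^k - 1 of those. *)

Local Notation convex_set := Defs.convex_set.

(** * Linear forms given by the dot product *)

Section DotProduct.
Context {R : realType} {d : nat}.
Implicit Types (u v x y z : 'rV[R]_d) (a : R).

Lemma dotvE u x : dotv u x = \sum_j u 0 j * x 0 j.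
Proof. by rewrite /dotv mxE; apply: eq_bigr => j _; rewrite mxE. Qed.

Lemma dotvC u x : dotv u x = dotv x u.
Proof. by rewrite !dotvE; apply: eq_bigr => j _; rewrite mulrC. Qed.

Lemma dotvDr u x y : dotv u (x + y) = dotv u x + dotv u y.
Proof. by rewrite !dotvE -big_split; apply: eq_bigr => j _; rewrite mxE mulrDr. Qed.

Lemma dotvZr u a x : dotv u (a *: x) = a * dotv u x.
Proof. by rewrite !dotvE big_distrr; apply: eq_bigr => j _; rewrite mxE mulrCA. Qed.

Lemma dotv0r u : dotv u 0 = 0.
Proof. by rewrite -(scale0r u) dotvZr mul0r. Qed.

Lemma dotv0l x : dotv 0 x = 0.
Proof. by rewrite dotvC dotv0r. Qed.

Lemma dotvNr u x : dotv u (- x) = - dotv u x.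
Proof. by rewrite -scaleN1r dotvZr mulN1r. Qed.

Lemma dotvBr u x y : dotv u (x - y) = dotv u x - dotv u y.
Proof. by rewrite dotvDr dotvNr. Qed.

Lemma dotvNl u x : dotv (- u) x = - dotv u x.
Proof. by rewrite dotvC dotvNr dotvC. Qed.

Lemma dotvZl a u x : dotv (a *: u) x = a * dotv u x.
Proof. by rewrite dotvC dotvZr dotvC. Qed.

Lemma dotvBl u v x : dotv (u - v) x = dotv u x - dotv v x.
Proof. by rewrite dotvC dotvBr !(dotvC x). Qed.

Lemma dotv_sumr (I : finType) u (F : I -> 'rV[R]_d) :
  dotv u (\sum_i F i) = \sum_i dotv u (F i).
Proof.
apply: (big_morph (dotv u) (id1 := 0)) => [x y|]; first exact: dotvDr.
exact: dotv0r.
Qed.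

Lemma dotv_gt0 u : u != 0 -> 0 < dotv u u.
Proof.
move=> u0; rewrite dotvE lt_neqAle sumr_ge0 ?andbT; last first.
  by move=> i _; rewrite -expr2 sqr_ge0.
apply: contra u0; rewrite eq_sym psumr_eq0; last first.
  by move=> i _; rewrite -expr2 sqr_ge0.
move=> /allP u0; apply/eqP/rowP => j; rewrite mxE; apply/eqP.
by have := u0 j (mem_index_enum j); rewrite mulf_eq0 orbb.
Qed.

Lemma continuous_dotvl x : continuous (fun u => dotv u x).
Proof.
rewrite (_ : (fun u => _) = (fun u => \sum_j u 0 j * x 0 j)); last first.
  by apply/funext => u; rewrite dotvE.
apply: (@continuous_big R _ +%R 0 xpredT add_continuous) => j _ u.

have H : (fun v : 'rV[R]_d => v 0 j) @ u --> u 0 j := @coord_continuous R 1 d 0 j u.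
exact: (cvgM H (@cvg_cst _ (x 0 j) _ _ _)).
Qed.

Lemma continuous_dotvr u : continuous (dotv u).
Proof.
rewrite (_ : dotv u = (fun x => dotv x u)); first exact: continuous_dotvl.
by apply/funext => x; rewrite dotvC.
Qed.

Lemma continuous_dotvv : continuous (fun x => dotv x x).
Proof.
rewrite (_ : (fun u => _) = (fun u => \sum_j u 0 j * u 0 j)); last first.
  by apply/funext => u; rewrite dotvE.
apply: (@continuous_big R _ +%R 0 xpredT add_continuous) => j _ u.

have H : (fun v : 'rV[R]_d => v 0 j) @ u --> u 0 j := @coord_continuous R 1 d 0 j u.
exact: (cvgM H H).
Qed.

Lemma closed_halfspace u a : closed [set x | dotv u x <= a].
Proof.
apply: (@closed_comp _ _ (dotv u) [set y | y <= a]); last exact: closed_le.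
by move=> x _; exact: continuous_dotvr.
Qed.

End DotProduct.

(** * Separation and support of compact convex sets *)

Section Separation.
Context {R : realType} {d : nat}.
Implicit Types (u v x y z : 'rV[R]_d) (a : R) (C K : set 'rV[R]_d).

(** The form is [y - z0], with [z0] the point of [K] nearest to [y]: a point of [K] on the wrong
    side would allow a move from [z0] inside [K] that comes closer to [y]. *)
Lemma convex_separation K y : K !=set0 -> compact K -> convex_set K -> ~ K y ->
  exists u, forall z, K z -> dotv u z < dotv u y.
Proof.
move=> K0 cK vK Ky.
have [|z0 /set_mem Kz0 minz0] :=
    @compact_EVT_min _ R (fun z => dotv (z - y) (z - y)) K K0 cK.
  apply: continuous_subspaceT => z.
  apply: (@continuous_comp _ _ _ (fun z => z - y) (fun w => dotv w w)).
    exact: (cvgB cvg_id (@cvg_cst _ y _ _ _)).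
  exact: continuous_dotvv.
exists (y - z0) => z Kz.
set u := y - z0.
have u0 : u != 0 by rewrite subr_eq0; apply/eqP => yz; apply: Ky; rewrite yz.
have uu := dotv_gt0 _ u0.
suff le0 : dotv u (z - z0) <= 0.
  have -> : y = z0 + u by rewrite /u addrC subrK.
  by move: le0; rewrite dotvBr dotvDr; lra.
rewrite leNgt; apply/negP => gt0.
set w := z - z0 in gt0.
have w0 : w != 0.
  by apply/eqP => w0; move: gt0; rewrite w0 dotv0r ltxx.
have ww := dotv_gt0 _ w0.
(* |u - t w|^2 = |u|^2 - 2 t (u.w) + t^2 (w.w) is below |u|^2 for small t > 0 *)
pose t := Num.min 1 (dotv u w / dotv w w).
have t0 : 0 < t by rewrite lt_min ltr01 divr_gt0.
have t1 : t <= 1 by rewrite ge_min lexx.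
have tw : t * dotv w w <= dotv u w.
  by rewrite -ler_pdivlMr// ge_min lexx orbT.
have Kt : K (z0 + t *: w) by apply: vK => //; rewrite (ltW t0).
have := minz0 _ (mem_set Kt).
have -> : z0 + t *: w - y = t *: w - u by rewrite /u opprB addrCA addrA.
have -> : z0 - y = - u by rewrite /u opprB.
clearbody u w.
rewrite !(dotvBr, dotvBl, dotvNr, dotvNl, dotvZr, dotvZl) (dotvC w u).
have := mulr_gt0 t0 gt0; have := ler_wpM2l (ltW t0) tw.
lra.
Qed.

Lemma compact_unit_sphere : compact [set u : 'rV[R]_d | `|u| = 1].
Proof.
apply: bounded_closed_compact.
  exists 1; split; first exact: real1.
  by move=> M M1 u /= u1; rewrite u1 ltW.
apply: (@closed_comp _ _ (@Num.norm _ 'rV[R]_d) [set y : R | y = 1]).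
  by move=> x _; exact: norm_continuous.
exact: closed_eq.
Qed.

(** If every nonzero form were larger somewhere on [K] than at [y], compactness of the unit sphere
    would extend this to some [t *: y] with [t > 1]. But that point lies outside [K] and is strictly
    separated from it. *)
Lemma exists_supporting K y : K !=set0 -> compact K -> convex_set K ->
  (forall t, 1 < t -> ~ K (t *: y)) ->
  exists2 u, u != 0 & forall z, K z -> dotv u z <= dotv u y.
Proof.
move=> K0 cK vK Ky; apply: contrapT => nosup.
have near1 : \forall t \near (1 : R), [set u : 'rV[R]_d | `|u| = 1] `<=`
    (fun u => exists2 z, K z & dotv u (t *: y) < dotv u z).
  (* Around each unit form [u] a single [z] works, by continuity, for all nearby forms and all [t]
     near 1. *)
  have /compact_near_coveringP /(_ R (nbhs (1 : R))) := compact_unit_sphere.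
  apply => u /= u1.
  have [z Kz uz] : exists2 z, K z & dotv u y < dotv u z.
    apply: contrapT => nz; apply: nosup; exists u.
      by rewrite -normr_eq0 u1 oner_eq0.
    by move=> z Kz; rewrite leNgt; apply/negP => uz; apply: nz; exists z.
  have cvg1 x : (fun p : 'rV[R]_d * R => dotv p.1 x) @ (u, 1 : R) --> dotv u x.
    apply: (@continuous_comp _ _ _ fst (fun v => dotv v x) (u, 1 : R)).
      exact: cvg_fst.
    exact: continuous_dotvl.
  have : (fun p : 'rV[R]_d * R => dotv p.1 z - p.2 * dotv p.1 y) @ (u, 1 : R) -->
      dotv u z - 1 * dotv u y.
    exact: (cvgB (cvg1 z) (cvgM cvg_snd (cvg1 y))).
  move=> /cvgr_gt /(_ 0); rewrite mul1r subr_gt0 => /(_ uz).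
  apply: filterS => -[v t] /= h; exists z => //.
  by rewrite dotvZr -subr_gt0.
have [t t1] : exists2 t : R, 1 < t & [set u : 'rV[R]_d | `|u| = 1] `<=`
    (fun u => exists2 z, K z & dotv u (t *: y) < dotv u z).
  have [e /= e0 he] := near1; exists (1 + e / 2); first by lra.
  by apply: he => /=; rewrite opprD addrA subrr sub0r normrN ger0_norm; lra.
move=> sph.
have [u hu] := convex_separation _ _ K0 cK vK (Ky t t1).
have u0 : u != 0.
  have [z /hu] := K0; apply: contraPneq => ->.
  by rewrite !dotv0l ltxx.
have [] := sph (`|u|^-1 *: u).
  by rewrite /= normrZ normfV normr_id mulVf ?normr_eq0.
move=> z Kz; rewrite !dotvZl ltr_pM2l ?invr_gt0 ?normr_gt0//.
by rewrite ltNge ltW// hu.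
Qed.

End Separation.

(** * Discrete subgroups, their classes modulo 2 and primitive vectors *)

Section DiscreteSubgroup.
Context {R : realType} {d : nat}.
Implicit Types (u v w : 'rV[R]_d) (G : set 'rV[R]_d).

(** Stated apart from [is_lattice] so as to cover also the lattice points of a proper subspace. *)
Definition discrete_subgroup G :=
  [/\ G 0, (forall x y, G x -> G y -> G (x - y)) &
      exists2 e : R, 0 < e & forall v, G v -> v != 0 -> e <= `|v|].

Lemma coord_le_norm v i : `|v 0 i| <= `|v|.
Proof.
rewrite [leRHS]/Num.norm /= mx_normrE.
by apply: (le_bigmax_cond 0 (fun ij => `|v ij.1 ij.2|) (j := (0, i))).
Qed.

Lemma norm_lt_coord v (e : R) : 0 < e -> (forall i, `|v 0 i| < e) -> `|v| < e.
Proof.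
move=> e0 ve; rewrite [ltLHS]/Num.norm /= mx_normrE.
by apply: bigmax_lt => // -[i j] _ /=; rewrite ord1.
Qed.

Section Theory.
Variable G : set 'rV[R]_d.
Hypothesis HG : discrete_subgroup G.

Let G0 : G 0. Proof. by case: HG. Qed.
Let GB x y : G x -> G y -> G (x - y). Proof. by case: HG => _ + _; apply. Qed.

Lemma subgroupN x : G x -> G (- x).
Proof. by move=> Gx; rewrite -sub0r; apply: GB. Qed.

Lemma subgroupD x y : G x -> G y -> G (x + y).
Proof. by move=> Gx Gy; rewrite -[y]opprK; apply: GB => //; apply: subgroupN. Qed.

Lemma subgroup_natZ n x : G x -> G (n%:R *: x).
Proof.
by move=> Gx; elim: n => [|n IH]; rewrite ?scale0r// -natr1 scalerDl scale1r; exact: subgroupD.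
Qed.

Lemma subgroup_intZ (z : int) x : G x -> G (z%:~R *: x).
Proof.
move=> Gx; case: z => n; first by rewrite -pmulrn; exact: subgroup_natZ.
by rewrite NegzE mulrNz scaleNr -pmulrn; apply/subgroupN/subgroup_natZ.
Qed.

Lemma subgroup_sum (I : finType) (P : pred I) (F : I -> 'rV[R]_d) :
  (forall i, P i -> G (F i)) -> G (\sum_(i | P i) F i).
Proof. by move=> GF; elim/big_rec: _ => // i x Pi; apply: subgroupD; exact: GF. Qed.

(** The cube of radius [M] is cut into cells of side [e], and [phi] records the cell of a point. Two
    points of one cell differ by less than [e] in each coordinate, hence coincide. *)
Lemma finite_bounded M : finite_set [set v | G v /\ `|v| <= M].
Proof.
have [_ _ [e e0 He]] := HG.
pose K := Num.truncn ((M + M) / e).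
pose phi v : {ffun 'I_d -> 'I_K.+1} :=
  [ffun i => inord (Num.truncn ((v 0 i + M) / e))].
set A := [set v | _].
have phi_inj : {in A &, injective phi}.
  move=> v w /set_mem[Gv vM] /set_mem[Gw wM] vw.
  apply/eqP; rewrite -subr_eq0; apply/negPn/negP => vw0.
  have := He _ (GB _ _ Gv Gw) vw0; apply/negP; rewrite -ltNge.
  apply: norm_lt_coord => // i; rewrite !mxE.
  have bnd x : G x -> `|x| <= M -> 0 <= (x 0 i + M) / e <= (M + M) / e.
    move=> Gx xM; have := coord_le_norm x i => /le_trans/(_ xM).
    rewrite ler_norml => /andP[x1 x2].
    by rewrite divr_ge0 ?(ltW e0)//= ?ler_pM2r ?invr_gt0//; lra.
  have [/andP[v0 v1] /andP[w0 w1]] := (bnd _ Gv vM, bnd _ Gw wM).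
  have := congr1 (fun f : {ffun _ -> 'I_K.+1} => nat_of_ord (f i)) vw.
  rewrite !ffunE !inordK ?ltnS ?le_truncn// => tt.
  have /andP[] := truncn_itv v0; have /andP[] := truncn_itv w0.
  rewrite tt; set t := Num.truncn _.
  rewrite !(ler_pdivlMr, ltr_pdivrMr)// -(natr1 t) mulrDl mul1r ltr_norml.
  by move=> *; apply/andP; split; lra.
apply: (@card_le_finite _ _ A [set: {ffun 'I_d -> 'I_K.+1}]); last exact: finite_finset.
by rewrite -(card_le_eql (inj_card_eq phi_inj)) card_leT.
Qed.

Lemma finite_set_nat_repeats (T : Type) (A : set T) (f : nat -> T) :
  finite_set A -> (forall n, A (f n)) -> exists i j, (i < j)%N /\ f i = f j.
Proof.
move=> finA Af; apply: contrapT => norep.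
have f_inj : {in [set: nat] &, injective f}.
  move=> i j _ _ fij; apply/eqP; case: (ltngtP i j) => // ij.
    by case: norep; exists i, j.
  by case: norep; exists j, i.
apply: infinite_nat; apply: card_le_finite finA.
rewrite -(card_le_eql (inj_card_eq f_inj)); apply: subset_card_le.
by move=> _ [n _ <-].
Qed.

(* The points [n r] reduced modulo the integer span of [v] lie in a bounded part
   of [G]; two of them coincide and their difference is an integer relation. *)
Lemma integer_relation m (v : 'I_m -> 'rV[R]_d) (r : 'I_m -> R) :
  (forall i, G (v i)) -> (exists i, r i != 0) -> \sum_i r i *: v i = 0 ->
  exists c : 'I_m -> int, (exists i, c i != 0) /\ \sum_i (c i)%:~R *: v i = 0.
Proof.
move=> Gv [i0 ri0] rv.
(* After this scaling the coefficient of [f n] at [i0] is [n] itself, so a coincidence [f i = f j]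
   gives a nonzero coefficient there. *)
wlog ri1 : r ri0 rv / r i0 = 1.
  move=> /(_ (fun i => r i / r i0)); apply; rewrite ?divff ?oner_eq0//.
  under eq_bigr do rewrite mulrC -scalerA.
  by rewrite -scaler_sumr rv scaler0.
pose f (n : nat) : 'rV[R]_d := \sum_i (Num.floor (n%:R * r i))%:~R *: v i.
have fE n : f n = \sum_i ((Num.floor (n%:R * r i))%:~R - n%:R * r i) *: v i.
  under [RHS]eq_bigr do rewrite scalerBl -scalerA.
  by rewrite sumrB -scaler_sumr rv scaler0 subr0.
have Gf n : [set w | G w /\ `|w| <= \sum_i `|v i|] (f n).
  split; first by apply: subgroup_sum => i _; exact: subgroup_intZ.
  rewrite fE; apply: le_trans (ler_norm_sum _ _ _) _; apply: ler_sum => i _.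
  rewrite normrZ ler_piMl// ler_norml.
  have /andP[] := floor_itv (n%:R * r i); rewrite intrD.
  by move=> *; apply/andP; split; lra.
have [i [j [ij fij]]] := finite_set_nat_repeats _ _ f (finite_bounded _) Gf.
exists (fun k => Num.floor (j%:R * r k) - Num.floor (i%:R * r k)); split.
  exists i0; rewrite ri1 !mulr1 subr_eq0.
  have floorn n : Num.floor (n%:R : R) = n := intrKfloor n%:Z.
  rewrite !floorn.
  by rewrite eqz_nat gtn_eqF.
under eq_bigr do rewrite intrD mulrNz scalerBl.
by rewrite sumrB -/(f j) -/(f i) fij subrr.
Qed.

Lemma int_even_or_odd (c : int) : (2 %| c)%Z \/ (exists q, c = 1 + q * 2).
Proof.
have := divz_eq c 2; have := modz_ge0 c (isT : 2 != 0 :> int).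
have := ltz_pmod c (isT : 0 < 2 :> int).
case E : (c %% 2)%Z => [[|[|n]]|n]// _ _ cE; last first.
  by right; exists (c %/ 2)%Z; rewrite {1}cE addrC.
by left; apply/dvdz_mod0P.
Qed.

(** While all coefficients are even the relation can be halved. This stops, because the absolute
    value of a nonzero coefficient drops each time. *)
Lemma odd_integer_relation m (v : 'I_m -> 'rV[R]_d) (c : 'I_m -> int) :
  (exists i, c i != 0) -> \sum_i (c i)%:~R *: v i = 0 ->
  exists c' : 'I_m -> int, (exists i, ~~ (2 %| c' i)%Z) /\
    \sum_i (c' i)%:~R *: v i = 0.
Proof.
move=> [i ci]; have [n] := ubnP `|c i|%N; elim: n => // n IH in c ci * => cn cv.
have [ev|] := pselect (forall i, (2 %| c i)%Z); last first.
  by move=> /existsNP[j /negP cj]; exists c; split=> //; exists j.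
have cE j : c j = (c j %/ 2)%Z * 2 by rewrite divzK.
apply: (IH (fun j => (c j %/ 2)%Z)).
- by apply: contra ci; rewrite {2}[c i]cE => /eqP ->.
- by move: cn ci; rewrite {1 2}[c i]cE; lia.
- have : 2 *: (\sum_j ((c j %/ 2)%Z)%:~R *: v j) = 0.
    rewrite scaler_sumr -[RHS]cv; apply: eq_bigr => j _.
    by rewrite {2}[c j]cE intrM mulrC scalerA.
  by move/eqP; rewrite scaler_eq0 pnatr_eq0 => /eqP.
Qed.

(** Reduce modulo 2 an integer relation that has an odd coefficient: [S] collects the odd positions,
    and everything else is twice an element of [G]. *)
Lemma even_subset_sum m (v : 'I_m -> 'rV[R]_d) (r : 'I_m -> R) :
  (forall i, G (v i)) -> (exists i, r i != 0) -> \sum_i r i *: v i = 0 ->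
  exists S : {set 'I_m}, S != finset.set0 /\
    exists q, G q /\ \sum_(i in S) v i = 2 *: q.
Proof.
move=> Gv r0 rv; have [c [c0 cv]] := integer_relation _ v r Gv r0 rv.
have {c c0 cv} [c [[j cj] cv]] := odd_integer_relation _ v c c0 cv.
pose S := [set i | ~~ (2 %| c i)%Z]%SET; exists S; split.
  by apply/set0Pn; exists j; rewrite inE.
pose h i := if i \in S then ((c i - 1) %/ 2)%Z else (c i %/ 2)%Z.
exists (- \sum_i (h i)%:~R *: v i); split.
  by apply: subgroupN; apply: subgroup_sum => i _; exact: subgroup_intZ.
rewrite scalerN scaler_sumr; apply/eqP; rewrite -addr_eq0; apply/eqP.
rewrite -[RHS]cv big_mkcond /= -big_split /=; apply: eq_bigr => i _.
rewrite scalerA /h; case: ifPn => [|]; rewrite inE.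
  case: (int_even_or_odd (c i)) => [->//|[q ->] _].
  by rewrite addrAC subrr add0r mulzK// intrD intrM scalerDl scale1r mulrC.
by rewrite negbK => ev; rewrite add0r -{2}(divzK ev) intrM mulrC.
Qed.

(** [phi v] gives the coordinates of the class of [v] in [G / 2G] with respect to a maximal family
    independent modulo 2. The family has at most [k] members, since more vectors are linearly
    dependent over the reals and [even_subset_sum] applies. *)
Lemma parity_classes k (A : 'M[R]_(k, d)) : (forall v, G v -> (v <= A)%MS) ->
  exists m (phi : 'rV[R]_d -> {set 'I_m}), [/\ (m <= k)%N,
    forall v w, G v -> G w -> phi v = phi w ->
      exists q, G q /\ v - w = 2 *: q &
    forall v, G v -> phi v = finset.set0 -> exists q, G q /\ v = 2 *: q].
Proof.
move=> GA.
(* Independence in [G / 2G] over the field with two elements: the only coefficients are 0 and 1, so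
   combinations are subset sums. *)
pose indep m := `[< exists u : 'I_m -> 'rV[R]_d, (forall i, G (u i)) /\
  forall S : {set 'I_m}, S != finset.set0 ->
    ~ exists q, G q /\ \sum_(i in S) u i = 2 *: q >].
have dep m (u : 'I_m -> 'rV[R]_d) : (forall i, G (u i)) -> (k < m)%N ->
    exists S : {set 'I_m}, S != finset.set0 /\
      exists q, G q /\ \sum_(i in S) u i = 2 *: q.
  move=> Gu km; pose M := \matrix_i u i.
  have : ~~ row_free M.
    rewrite /row_free neq_ltn (leq_ltn_trans _ km)// (leq_trans _ (rank_leq_row A))//.
    by apply/mxrankS/row_subP => i; rewrite rowK; exact: GA.
  rewrite -kermx_eq0 => /rowV0Pn[r /sub_kermxP rM r0].
  apply: (even_subset_sum _ u (r 0)) => //.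
    by have /rV0Pn := r0.
  rewrite -[RHS]rM mulmx_sum_row; apply: eq_bigr => i _.
  by rewrite rowK.
have [||m /asboolP[u [Gu ind]] mmax] := @ex_maxnP indep k.
- exists 0%N; apply/asboolP; exists (fun=> 0); split=> // S.
  by move=> /set0Pn[[]].
- move=> m /asboolP[u [Gu ind]]; rewrite leqNgt; apply/negP => km.
  by have [S [S0 Sq]] := dep _ _ Gu km; exact: (ind S).
have mk : (m <= k)%N.
  rewrite leqNgt; apply/negP => km.
  by have [S [S0 Sq]] := dep _ _ Gu km; exact: (ind S).
have rep v : exists S : {set 'I_m}, G v ->
    exists q, G q /\ v + \sum_(i in S) u i = 2 *: q.
  have [Gv|] := pselect (G v); last by exists finset.set0.
  (* Put [v] in front of the maximal family. The longer family is dependent, and a dependent subset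
     must contain [v]. *)
  pose u' (i : 'I_m.+1) := oapp u v (unlift ord0 i).
  have [ind'|] := pselect (forall S : {set 'I_m.+1}, S != finset.set0 ->
    ~ exists q, G q /\ \sum_(i in S) u' i = 2 *: q).
    have : indep m.+1.
      apply/asboolP; exists u'; split=> // i.
      by rewrite /u'; case: unliftP => [j|] _ //=; exact: Gu.
    by move/mmax; rewrite ltnn.
  move=> /existsNP[S /not_implyP[S0 /contrapT[q [Gq Sq]]]].
  pose S' := [set i | lift ord0 i \in S]%SET.
  have sumE : \sum_(i in S) u' i = (if ord0 \in S then v else 0) + \sum_(i in S') u i.
    rewrite big_mkcond big_ord_recl /= {1}/u' unlift_none; congr (_ + _).
    rewrite [RHS]big_mkcond; apply: eq_bigr => i _.
    by rewrite /u' liftK inE.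
  exists S' => _; move: sumE; case: ifPn => [_|S00].
    by move=> <-; exists q.
  rewrite add0r Sq => S'q; case: (ind S'); last by exists q.
  have /set0Pn[i iS] := S0; case: (unliftP ord0 i) iS S00 => [j ->|->]; last by move=> ->.
  by move=> jS _; apply/set0Pn; exists j; rewrite inE.
have [phi Hphi] := choice rep.
exists m, phi; split=> //.
  move=> v w Gv Gw vw; have [q [Gq vq]] := Hphi v Gv.
  have [q' [Gq' wq]] := Hphi w Gw.
  exists (q - q'); split; first exact: GB.
  by rewrite scalerBr -vq -wq vw opprD addrACA subrr addr0.
by move=> v Gv v0; have := Hphi v Gv; rewrite v0 big_set0 addr0.
Qed.

(** By discreteness the positive scalars [s] with [s *: v] in [G] have a least member [g]. Then
    [g *: v] is primitive, and [g^-1] is an integer because 1 is one of these scalars. *)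
Lemma primitive_multiple v : G v -> v != 0 ->
  exists w (n : nat), [/\ primitive_in G w, (0 < n)%N & v = n%:R *: w].
Proof.
move=> Gv v0; have [_ _ [e e0 He]] := HG.
have nv : 0 < `|v| by rewrite normr_gt0.
pose E := [set s : R | 0 < s /\ G (s *: v)].
have E1 : E 1 by split; rewrite ?scale1r.
have lbE s : E s -> e / `|v| <= s.
  move=> [s0 Gs]; rewrite ler_pdivrMr// -[s in leRHS]gtr0_norm// -normrZ.
  by apply: He => //; rewrite scaler_eq0 negb_or gt_eqF.
have infE : has_inf E by split; [exists 1 | exists (e / `|v|)].
pose g := inf E.
have g0 : 0 < g.
  apply: lt_le_trans (_ : e / `|v| <= _); first exact: divr_gt0.
  by apply: lb_le_inf => //; exists 1.
have gE s : E s -> g <= s by move=> Es; apply: ge_inf => //; case: infE.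
(* If the infimum were not attained, two distinct members of [E] below [2 * g] would differ by less
   than [g]. *)
have Eg : E g.
  have [s Es sg] := inf_adherent g0 infE.
  have := gE _ Es; rewrite le_eqVlt => /orP[/eqP -> //|gs].
  have [s' Es' s'g] : exists2 s', E s' & s' < inf E + (s - g).
    by apply: inf_adherent => //; rewrite subr_gt0.
  have gs' := gE _ Es'.
  have Ess' : E (s - s').
    split; first by rewrite -/g in s'g; lra.
    by rewrite scalerBl; apply: GB; [case: Es | case: Es'].
  by have := gE _ Ess'; rewrite -/g in sg; lra.
(* The remainder of [s] modulo [g] is below [g], so it cannot be positive. *)
have int s : G (s *: v) -> s / g \is a Num.int.
  move=> Gs; rewrite intrEfloor; set z := Num.floor _.
  have /andP[z1 z2] := floor_itv (s / g); rewrite -/z in z1 z2.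
  rewrite ler_pdivlMr// in z1; rewrite intrD ltr_pdivrMr// in z2.
  have Gz : G ((s - z%:~R * g) *: v).
    by rewrite scalerBl -scalerA; apply: GB => //; apply: subgroup_intZ; case: Eg.
  have := z1; rewrite le_eqVlt => /orP[/eqP zs|zs].
    apply/eqP; apply: (mulIf (lt0r_neq0 g0)).
    by rewrite zs divfK ?gt_eqF.
  have := gE (s - z%:~R * g); rewrite /E /= subr_gt0 => /(_ (conj zs Gz)).
  by lra.
have := int 1; rewrite scale1r => /(_ Gv); rewrite div1r => gi.
have : g^-1 \is a Num.nat by rewrite natrEint gi invr_ge0 ltW.
move=> /natrP[n gn]; exists (g *: v), n; split.
- split; first by case: Eg.
  split; first by rewrite scaler_eq0 negb_or gt_eqF.
  move=> w s Gw ws; rewrite -[s](@mulfK _ g) ?gt_eqF//; apply: int.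
  by rewrite -scalerA -ws.
- by rewrite -(ltr0n R) -gn invr_gt0.
- by rewrite scalerA -gn mulVf ?gt_eqF// scale1r.
Qed.

End Theory.
End DiscreteSubgroup.

(** * Polyhedra, their vertices and their facets *)

Section Polyhedron.
Context {R : realType} {d : nat}.
Implicit Types (u v w x y z : 'rV[R]_d).

(** The formula of [is_polytope] over any finite index type, since vertices will be indexed by sets
    of constraints. *)
Definition hull (T : finType) (p : T -> 'rV[R]_d) : set 'rV[R]_d :=
  [set x | exists w : T -> R,
     [/\ (forall i, 0 <= w i), \sum_i w i = 1 & x = \sum_i w i *: p i]].

Lemma hull_point (T : finType) (p : T -> 'rV[R]_d) i : hull T p (p i).
Proof.
exists (fun j => (j == i)%:R); split=> [j||]; first exact: ler0n.
  by rewrite (bigD1 i)//= eqxx big1 ?addr0// => j /negbTE ->.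
rewrite (bigD1 i)//= eqxx scale1r big1 ?addr0// => j /negbTE ->.
by rewrite scale0r.
Qed.

Lemma hull_convex (T : finType) (p : T -> 'rV[R]_d) : convex_set (hull T p).
Proof.
move=> x y t [wx [wx0 wx1 ->]] [wy [wy0 wy1 ->]] /andP[t0 t1].
exists (fun i => (1 - t) * wx i + t * wy i); split.
- by move=> i; rewrite addr_ge0// mulr_ge0// subr_ge0.
- by rewrite big_split -!mulr_sumr wx1 wy1 /= !mulr1 subrK.
- rewrite -sumrB scaler_sumr -big_split; apply: eq_bigr => i _ /=.
  by apply/rowP => j; rewrite !mxE; ring.
Qed.

Lemma is_polytope_hull (T : finType) (p : T -> 'rV[R]_d) : is_polytope (hull T p).
Proof.
exists #|T|, (fun i => p (enum_val i)); apply/seteqP; split=> x [w [w0 w1 ->]].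
  exists (fun i => w (enum_val i)); split=> [i||]; first exact: w0.
    by rewrite -w1 [RHS](reindex _ (onW_bij _ (@enum_val_bij T))).
  by rewrite (reindex _ (onW_bij _ (@enum_val_bij T))).
exists (fun i => w (enum_rank i)); split=> [i||]; first exact: w0.
  by rewrite -w1 [RHS](reindex _ (onW_bij _ (@enum_rank_bij T))).
rewrite (reindex _ (onW_bij _ (@enum_rank_bij T))) /=.
by apply: eq_bigr => i _; rewrite enum_rankK.
Qed.

Section Halfspaces.
Variables (I : finType) (n : I -> 'rV[R]_d) (b : I -> R).

Definition polyhedron : set 'rV[R]_d := [set x | forall i, dotv (n i) x <= b i].

Definition tight x := [set i | dotv (n i) x == b i]%SET.

(** Travel from [x] along [w] until the first new constraint is reached; those tight at [x] stay
    tight. If no constraint grows along [w], the whole ray stays inside. *)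
Lemma polyhedron_move x w : polyhedron x ->
  (forall i, i \in tight x -> dotv (n i) w = 0) ->
  (forall t, 0 <= t -> polyhedron (x + t *: w)) \/
  exists2 t, 0 < t & polyhedron (x + t *: w) /\ tight x \proper tight (x + t *: w).
Proof.
move=> Px tw.
have [/existsP[i0 wi0]|] := boolP [exists i, 0 < dotv (n i) w]; last first.
  move=> /existsPn nw; left => t t0 i; rewrite dotvDr dotvZr.
  have := nw i; rewrite -leNgt => /(ler_wpM2l t0); rewrite mulr0.
  by have := Px i; lra.
(* The time at which a constraint growing along [w] becomes tight. *)
pose h i := (b i - dotv (n i) x) / dotv (n i) w.
have [i wi hmin] := @arg_minP _ _ I i0 (fun i => 0 < dotv (n i) w) h wi0.
have hi0 : 0 < h i.
  rewrite divr_gt0// subr_gt0 lt_neqAle Px andbT.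
  by apply: contraL wi => /= iT; rewrite (tw i) ?ltxx// inE.
right; exists (h i) => //; split.
  move=> j; rewrite dotvDr dotvZr.
  have [wj|wj] := ltP 0 (dotv (n j) w).
    by have := hmin j wj; rewrite ler_pdivlMr//; lra.
  by have := ler_wpM2l (ltW hi0) wj; rewrite mulr0; have := Px j; lra.
have wi_n0 : dotv (n i) w != 0 by rewrite gt_eqF.
apply/properP; split.
  apply/fintype.subsetP => j jx; move: (jx); rewrite !inE dotvDr dotvZr => /eqP ->.
  by rewrite tw// mulr0 addr0.
exists i; first by rewrite inE dotvDr dotvZr divfK// addrC subrK.
by apply: contraL wi => /tw ->; rewrite ltxx.
Qed.

Lemma polyhedron_convex : convex_set polyhedron.
Proof.
move=> x y t Px Py /andP[t0 t1] i; rewrite dotvDr dotvZr dotvBr.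
have t1' : 0 <= 1 - t by rewrite subr_ge0.
by have := ler_wpM2l t0 (Py i); have := ler_wpM2l t1' (Px i); lra.
Qed.

Lemma polyhedron_hull (T : finType) (p : T -> 'rV[R]_d) :
  (forall i, polyhedron (p i)) -> hull T p `<=` polyhedron.
Proof.
move=> Pp x [w [w0 w1 ->]] i; rewrite dotv_sumr.
rewrite -[b i]mul1r -w1 mulr_suml; apply: ler_sum => j _.
by rewrite dotvZr ler_wpM2l// Pp.
Qed.

Lemma closed_polyhedron : closed polyhedron.
Proof.
rewrite (_ : polyhedron = \bigcap_i [set x | dotv (n i) x <= b i]); last first.
  by apply/seteqP; split=> [x Px i _|x Px i]; [exact: Px | exact: (Px i)].
by apply: closed_bigI => i _; exact: closed_halfspace.
Qed.

(* The vertices are the points determined by their set of tight constraints; any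
   other point moves both ways along a line until a new constraint gets tight. *)
Lemma bounded_polyhedron_polytope M : polyhedron !=set0 ->
  (forall x, polyhedron x -> `|x| <= M) -> is_polytope polyhedron.
Proof.
move=> [x0 Px0] PM.
(* [p S] is a point with tight set [S], and merely some point of the polyhedron if there is none. *)
have /choice[p Hp] (S : {set I}) : exists y, polyhedron y /\
    ((exists2 x, polyhedron x & tight x = S) -> tight y = S).
  have [[x Px xS]|nx] := pselect (exists2 x, polyhedron x & tight x = S).
    by exists x.
  by exists x0.
suff -> : polyhedron = hull _ p by exact: is_polytope_hull.
apply/seteqP; split; last by apply: polyhedron_hull => S; case: (Hp S).
(* Induction on the number of constraints that are not tight at [x]. *)
move=> x Px; have [m] := ubnP #|~: tight x|; elim: m => // m IH in x Px *.
rewrite ltnS => xm.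
have move_tight w : w != 0 -> (forall i, i \in tight x -> dotv (n i) w = 0) ->
    exists2 t, 0 < t & hull _ p (x + t *: w).
  move=> w0 wx; have [ray|[t t0 [Pt ptight]]] := polyhedron_move x w Px wx.
    have nw : 0 < `|w| by rewrite normr_gt0.
    (* At this time the ray has norm at least [M + 1], against the bound [M]. *)
    pose t := (M + `|x| + 1) / `|w|.
    have M0 : 0 <= M by apply: le_trans (PM _ Px0).
    have t0 : 0 <= t by rewrite divr_ge0 ?addr_ge0.
    have := PM _ (ray t t0).
    have := lerB_normD (t *: w) x; rewrite [_ + x]addrC.
    rewrite normrZ (ger0_norm t0) divfK ?gt_eqF//.
    by move=> h1 h2; exfalso; lra.
  exists t => //; apply: IH => //; apply: leq_trans xm.
  by apply: proper_card; rewrite properE !finset.setCS -properE.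
have [[w w0 wx]|vertex] := pselect (exists2 w, w != 0 &
    forall i, i \in tight x -> dotv (n i) w = 0).
  have [t1 t10 h1] := move_tight w w0 wx.
  have [||t2 t20 h2] := move_tight (- w); first by rewrite oppr_eq0.
    by move=> i /wx wi; rewrite dotvNr wi oppr0.
  have -> : x = (x + t1 *: w) + (t1 / (t1 + t2)) *: ((x + t2 *: - w) - (x + t1 *: w)).
    apply/rowP => j; rewrite !mxE; field.
    by rewrite gt_eqF// addr_gt0.
  apply: hull_convex => //.
  by rewrite divr_ge0 ?addr_ge0 ?(ltW t10) ?(ltW t20)//= ler_pdivrMr ?addr_gt0//; lra.
(* [x] and [p (tight x)] have the same tight set, so a nonzero difference would be a direction of
   the kind just excluded. *)
have [_ Hpx] := Hp (tight x).
have xp := Hpx (ex_intro2 _ _ x Px erefl).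
suff -> : x = p (tight x) by exact: hull_point.
apply/eqP; rewrite -subr_eq0; apply/negPn/negP => xp0; apply: vertex.
exists (x - p (tight x)) => // i ix.
have := ix; rewrite inE dotvBr => /eqP ->.
by move: ix; rewrite -{1}xp inE => /eqP ->; rewrite subrr.
Qed.

(** Some constraint is tight at the centroid of [d] affinely independent points of [F], since
    otherwise the centroid could move outwards along [u]. It is then tight at each of these points,
    so its hyperplane is that of the facet. *)
Lemma facet_polyhedron F : (forall i, n i != 0) -> facet polyhedron F ->
  exists i, F = [set x | polyhedron x /\ dotv (n i) x = b i].
Proof.
move=> n0 [u [c [u0 Pu FE [X [FX rankX]]]]].
have FXc i : polyhedron (row i X) /\ dotv u (row i X) = c by have := FX i; rewrite FE.
have d0 : (0 < d)%N.
  by rewrite lt0n; apply: contraNneq u0 => d0; apply/eqP/rowP => -[i lti]; exfalso; rewrite d0 in lti.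
have dR : 0 < d%:R :> R by rewrite ltr0n.
pose x := d%:R^-1 *: \sum_i row i X.
have dotx v : dotv v x = d%:R^-1 * \sum_i dotv v (row i X).
  by rewrite dotvZr dotv_sumr.
have avg (a : R) : d%:R^-1 * \sum_(i < d) a = a.
  by rewrite sumr_const card_ord -[a *+ d]mulr_natl mulKf ?gt_eqF.
have Px : polyhedron x.
  move=> i; rewrite dotx -[b i]avg ler_pM2l ?invr_gt0//.
  by apply: ler_sum => j _; case: (FXc j) => + _; apply.
have ux : dotv u x = c.
  by rewrite dotx -[RHS]avg; congr (_ * _); apply: eq_bigr => j _; case: (FXc j).
have [i ix] : exists i, i \in tight x.
  apply: contrapT => nt.
  have [t t0 Pt] : exists2 t, 0 < t & polyhedron (x + t *: u).
    have [||ray|[t t0 [Pt _]]] := polyhedron_move x u; rewrite //.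
    - by move=> i ix; case: nt; exists i.
    - by exists 1 => //; exact: ray.
    - by exists t.
  have := Pu _ Pt; rewrite dotvDr ux dotvZr.
  by have := mulr_gt0 t0 (dotv_gt0 _ u0); lra.
have nX j : dotv (n i) (row j X) = b i.
  apply/eqP; rewrite -subr_eq0 -oppr_eq0 opprB.
  have : \sum_j (b i - dotv (n i) (row j X)) = 0.
    move: ix; rewrite inE dotx -[X in _ == X]avg.
    move=> /eqP /(mulfI (invr_neq0 (lt0r_neq0 dR))) h.
    by rewrite sumrB h subrr.
  move=> /eqP; rewrite psumr_eq0; last first.
    by move=> l _; rewrite subr_ge0; case: (FXc l) => + _; apply.
  by move=> /allP /(_ j (mem_index_enum j)).
(* Equations satisfied by all rows of [X] form the kernel of the homogenised matrix, a line because
   the rank is [d]; so two of them are proportional. *)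
have [l ln lb] : exists2 l, n i = l *: u & b i = l * c.
  pose A := row_mx X (const_mx 1 : 'M[R]_(d, 1)).
  have inker v a : (forall j, dotv v (row j X) = a) ->
      (row_mx v (- a)%:M <= kermx A^T)%MS.
    move=> va; apply/sub_kermxP; rewrite tr_row_mx mul_row_col.
    apply/rowP => j; rewrite !mxE big_ord1 !mxE eqxx mulr1n mulr1 -(va j) dotvE.
    by apply/eqP; rewrite subr_eq0; apply/eqP; apply: eq_bigr => k _; rewrite !mxE.
  have uk := inker u c (fun j => (FXc j).2).
  have nk := inker (n i) (b i) nX.
  have rk : \rank (kermx A^T) = 1%N by rewrite mxrank_ker mxrank_tr rankX addKn.
  have u'0 : row_mx u (- c)%:M != 0.
    apply: contra u0 => /eqP /(congr1 lsubmx); rewrite row_mxKl => ->.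
    by apply/eqP/rowP => j; rewrite !mxE.
  have ku : (kermx A^T <= row_mx u (- c)%:M)%MS.
    have := mxrank_leqif_sup uk; rewrite rk rank_rV u'0 /= => /leqif_refl.
    by [].
  have /sub_rVP[l ln] := submx_trans nk ku.
  exists l.
    by have := congr1 lsubmx ln; rewrite scale_row_mx !row_mxKl.
  have := congr1 rsubmx ln; rewrite scale_row_mx !row_mxKr => /rowP /(_ 0).
  by rewrite !mxE eqxx !mulr1n mulrN => /oppr_inj.
have l0 : l != 0 by apply: contraNneq (n0 i) => l0; rewrite ln l0 scale0r.
exists i; rewrite FE; apply/seteqP; split=> y /= [Py yc]; split=> //.
  by rewrite ln dotvZl lb yc.
by move: yc; rewrite ln dotvZl lb => /(mulfI l0).
Qed.

End Halfspaces.
End Polyhedron.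

(** * Difference bodies and elementary facts on convex bodies *)

Section DifferenceBody.
Context {R : realType} {d : nat}.
Implicit Types (u v w x y z : 'rV[R]_d) (C : set 'rV[R]_d).

Definition difference_body C : set 'rV[R]_d :=
  [set z | exists x y, [/\ C x, C y & z = x - y]].

Lemma difference_body_convex C : convex_set C -> convex_set (difference_body C).
Proof.
move=> vC _ _ t [x [y [Cx Cy ->]]] [x' [y' [Cx' Cy' ->]]] t01.
exists (x + t *: (x' - x)), (y + t *: (y' - y)); split; [exact: vC..|].
by apply/rowP => j; rewrite !mxE; ring.
Qed.

Lemma difference_bodyN C z : difference_body C z -> difference_body C (- z).
Proof. by move=> [x [y [Cx Cy ->]]]; exists y, x; rewrite opprB. Qed.

Lemma compact_add (A B : set 'rV[R]_d) : compact A -> compact B ->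
  compact [set x + y | x in A & y in B].
Proof.
move=> cA cB; rewrite (_ : [set _ | _ in _ & _ in _] =
  (fun p => p.1 + p.2) @` (A `*` B)).
  apply: continuous_compact; last exact: compact_setX.
  by apply: continuous_subspaceT; exact: add_continuous.
apply/seteqP; split=> [_ [x Ax [y By <-]]|_ [[x y] [Ax By] <-]].
  by exists (x, y).
by exists x => //; exists y.
Qed.

Lemma difference_body_compact C : compact C -> compact (difference_body C).
Proof.
move=> cC; rewrite (_ : difference_body C = [set x + y | x in C & y in -%R @` C]).
  apply: compact_add => //; apply: continuous_compact => //.
  by apply: continuous_subspaceT; exact: opp_continuous.
apply/seteqP; split=> [_ [x [y [Cx Cy ->]]]|_ [x Cx [_ [y Cy <-] <-]]].
  by exists x => //; exists (- y) => //; exists y.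
by exists x, y.
Qed.

Lemma compact_norm_bound C : compact C -> exists2 M, 0 < M & forall x, C x -> `|x| <= M.
Proof.
move=> /compact_bounded [M [_ hM]]; exists (`|M| + 1); first by rewrite ltr_wpDl.
by move=> x Cx; apply: hM => //; rewrite (le_lt_trans (ler_norm M))// ltrDl.
Qed.

Lemma segment_subset C x y : convex_set C -> C x -> C y -> segment x y `<=` C.
Proof. by move=> vC Cx Cy _ [t [t01 ->]]; exact: vC. Qed.

Lemma segment_left x y : segment x y x.
Proof. by exists 0; rewrite lexx ler01 scale0r addr0. Qed.

Lemma segment_right x y : segment x y y.
Proof. by exists 1; rewrite lexx ler01 scale1r addrC subrK. Qed.

Lemma interior_move C : interior C !=set0 ->
  exists2 x, C x & forall w, exists2 h, 0 < h & C (x + h *: w).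
Proof.
move=> [x Cx]; exists x; first exact: interior_subset.
move=> w; have /nbhs_ballP[e /= e0 eC] := Cx.
have w0 : 0 < `|w| + 1 by rewrite ltr_wpDl.
(* The [+ 1] keeps the divisor positive when [w = 0]. *)
exists (e / 2 / (`|w| + 1)); first by rewrite !divr_gt0.
apply: eC; rewrite -ball_normE /= opprD addrA subrr sub0r normrN normrZ.
rewrite ger0_norm ?divr_ge0 ?ltW//.
have w1 : `|w| / (`|w| + 1) <= 1 by rewrite ler_pdivrMr// mul1r lerDl.
have e2 : 0 <= e / 2 by lra.
by rewrite mulrAC -mulrA; have := ler_wpM2l e2 w1; lra.
Qed.

End DifferenceBody.

(** * Bounds for the lattice diameter *)

Section LatticeDiameter.
Context {R : realType} {d : nat}.
Implicit Types (u v w x y z : 'rV[R]_d) (C : set 'rV[R]_d).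
Variable L : set 'rV[R]_d.
Hypothesis HL : is_lattice L.

Lemma lattice_discrete : discrete_subgroup L.
Proof. by case: HL. Qed.

Lemma lattice_nonzero : (0 < d)%N -> exists2 v, L v & v != 0.
Proof.
move=> d0; have [_ _ _ [B [LB uB]]] := HL.
exists (row (Ordinal d0) B) => //; apply/eqP => B0.
have := congr1 (mulmx^~ (invmx B)) B0; rewrite /= mul0mx rowE mulmxK// => /matrixP.
by move=> /(_ 0 (Ordinal d0)); rewrite !mxE !eqxx => /eqP; rewrite oner_eq0.
Qed.

Lemma lattice_lengths_bounded C : compact C ->
  has_ubound [set t | exists a b, lattice_length L a b t /\ segment a b `<=` C].
Proof.
move=> /compact_norm_bound[M M0 HM]; have [_ _ [e e0 He] _] := HL.
exists ((M + M) / e) => t [x [y [[v [[Lv [v0 _]] [t0 xy]]] xyC]]].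
rewrite ler_pdivlMr//; apply: (@le_trans _ _ `|y - x|).
  by rewrite xy normrZ ger0_norm// ler_wpM2l// He.
apply: le_trans (ler_normB _ _) _.
by rewrite lerD// HM//; apply: xyC; [exact: segment_right | exact: segment_left].
Qed.

(** If [v] is [n] times a primitive vector, the segment has lattice length [t * n], which is at
    least [t]. *)
Lemma lattice_diam_ge C v x t : convex_body C -> L v -> v != 0 -> 0 <= t ->
  C x -> C (x + t *: v) -> t <= lattice_diam L C.
Proof.
move=> [cC [vC _]] Lv v0 t0 Cx Cxt.
have [w [n [Pw n0 vw]]] := primitive_multiple _ lattice_discrete v Lv v0.
apply: (@le_trans _ _ (t * n%:R)); first by rewrite ler_peMr// ler1n.
apply: ub_le_sup; first exact: lattice_lengths_bounded.
exists x, (x + t *: v); split; last exact: segment_subset.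
exists w; split=> //; split; first exact: mulr_ge0.
by rewrite addrAC subrr add0r vw scalerA.
Qed.

Lemma lattice_diam_le C D : (0 < d)%N -> C !=set0 ->
  (forall v x t, L v -> v != 0 -> 0 <= t -> C x -> C (x + t *: v) -> t <= D) ->
  lattice_diam L C <= D.
Proof.
move=> d0 [x Cx] HD; apply: ge_sup.
  (* A degenerate segment shows that the set of lengths is nonempty. *)
  have [v Lv v0] := lattice_nonzero d0.
  have [w [n [Pw _ _]]] := primitive_multiple _ lattice_discrete v Lv v0.
  exists 0, x, x; split; first by exists w; rewrite subrr scale0r.
  by move=> _ [t [_ ->]]; rewrite subrr scaler0 addr0.
move=> t [y [z [[v [[Lv [v0 _]] [t0 yz]]] yzC]]].
apply: (HD v y) => //; first exact/yzC/segment_left.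
by rewrite -yz addrC subrK; exact/yzC/segment_right.
Qed.

Lemma lattice_diam_gt0 C : (0 < d)%N -> convex_body C -> 0 < lattice_diam L C.
Proof.
move=> d0 bC; have [v Lv v0] := lattice_nonzero d0.
have [_ [_ /interior_move[x Cx /(_ v)[h h0 Ch]]]] := bC.
exact: (lt_le_trans h0 (lattice_diam_ge C v x h bC Lv v0 (ltW h0) Cx Ch)).
Qed.

End LatticeDiameter.

(** * Diameter directions and faces of the difference body *)

Section DiameterDirections.
Context {R : realType} {d : nat}.
Implicit Types (u v w x y z : 'rV[R]_d).
Variables (L C : set 'rV[R]_d).
Hypotheses (HL : is_lattice L) (bC : convex_body C) (d0 : (0 < d)%N).

Local Notation delta := (lattice_diam L C).
Local Notation K := (difference_body C).
Local Notation dir := (diameter_direction L C).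

Let cC : compact C. Proof. by case: bC. Qed.
Let vC : convex_set C. Proof. by case: bC => _ []. Qed.
Let delta0 : 0 < delta. Proof. exact: lattice_diam_gt0. Qed.
Let C0 : exists x, C x.
Proof. by have [_ [_ [x /interior_subset Cx]]] := bC; exists x. Qed.
Let vK : convex_set K. Proof. exact: difference_body_convex. Qed.
Let K0 : K 0. Proof. by have [x Cx] := C0; exists x, x; rewrite subrr. Qed.

Lemma diff_scale_le v t : L v -> v != 0 -> 0 <= t -> K (t *: v) -> t <= delta.
Proof.
move=> Lv v0 t0 [x [y [Cx Cy xy]]].
apply: (lattice_diam_ge _ HL _ v y) => //.
by rewrite xy addrC subrK.
Qed.

Lemma diameter_directionP v : dir v <-> [/\ L v, v != 0 & K (delta *: v)].
Proof.
split=> [[Lv [v0 [x xC]]]|[Lv v0 [x [y [Cx Cy xy]]]]].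
  split=> //; exists (x + delta *: v), x; split.
  - exact/xC/segment_right.
  - exact/xC/segment_left.
  - by rewrite addrAC subrr add0r.
split=> //; split=> //; exists y; apply: segment_subset => //.
by rewrite xy addrC subrK.
Qed.

Lemma diameter_directionN v : dir v -> dir (- v).
Proof.
move=> /diameter_directionP[Lv v0 Kv]; apply/diameter_directionP; split.
- exact: (subgroupN _ (lattice_discrete _ HL)).
- by rewrite oppr_eq0.
- by rewrite scalerN; exact: difference_bodyN.
Qed.

(** Otherwise [C] would contain a segment of length [2 * delta] in direction [q]. *)
Lemma diameter_direction_half v q : L q -> v = 2 *: q -> ~ dir v.
Proof.
move=> Lq vq /diameter_directionP[_ v0]; rewrite vq scalerA => Kq.
have q0 : q != 0 by apply: contraNneq v0 => q0; rewrite vq q0 scaler0.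
have := diff_scale_le q _ Lq q0 (mulr_ge0 (ltW delta0) (ler0n _ 2)) Kq.
by move: delta0; lra.
Qed.

Lemma finite_diameter_directions : finite_set dir.
Proof.
have [M M0 HM] := compact_norm_bound _ (difference_body_compact _ cC).
apply: sub_finite_set (finite_bounded _ (lattice_discrete _ HL) (M / delta)).
move=> v /diameter_directionP[Lv v0 Kv]; split=> //.
by rewrite ler_pdivlMr// mulrC -[delta in leLHS]gtr0_norm// -normrZ HM.
Qed.

Definition supports u v := forall z, K z -> dotv u z <= dotv u (delta *: v).

Lemma supportsN u v : supports u v -> supports (- u) (- v).
Proof.
move=> uv z /difference_bodyN /uv; rewrite scalerN !dotvNl !dotvNr; lra.
Qed.

(** No [t *: (delta *: v)] with [t > 1] lies in [K], by maximality of [delta], so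
    [exists_supporting] applies. *)
Lemma exists_supports v : dir v -> exists2 u, u != 0 & supports u v.
Proof.
move=> /diameter_directionP[Lv v0 Kv]; apply: exists_supporting => //.
- by exists 0.
- exact: difference_body_compact.
move=> t t1; rewrite scalerA => Kt.
have t0 : 0 <= t * delta by rewrite mulr_ge0 ?(ltW delta0)// (le_trans ler01)// ltW.
by have := diff_scale_le v _ Lv v0 t0 Kt; rewrite leNgt ltr_pMl// t1.
Qed.

(** [K] contains a positive multiple of [u], where the form [u] is already positive. *)
Lemma supports_gt0 u v : u != 0 -> supports u v -> 0 < dotv u (delta *: v).
Proof.
move=> u0 uv; have [_ [_ /interior_move[x Cx /(_ u)[h h0 Cxh]]]] := bC.
apply: (@lt_le_trans _ _ (dotv u (h *: u))).
  by rewrite dotvZr mulr_gt0// dotv_gt0.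
by apply: uv; exists (x + h *: u), x; split=> //; rewrite addrAC subrr add0r.
Qed.

(* [face w v]: [w] lies in the smallest face of [K / delta] containing [v]. *)
Definition face w v := forall u, supports u v -> supports u w.

Lemma faceN w v : face w v -> face (- w) (- v).
Proof.
move=> wv u /supportsN; rewrite opprK => /wv /supportsN; by rewrite opprK.
Qed.

(** A maximum that is the average of two values is attained by both. *)
Lemma face_midpoint v w p : dir v -> dir w -> 2 *: p = v + w -> face v p.
Proof.
move=> /diameter_directionP[_ _ Kv] /diameter_directionP[_ _ Kw] pE u up z Kz.
have : 2 * dotv u (delta *: p) = dotv u (delta *: v) + dotv u (delta *: w).
  by rewrite -dotvZr -dotvDr -scalerDr -pE !scalerA mulrC.
by have := up _ Kw; have := up _ Kz; lra.
Qed.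

Lemma diameter_direction_midpoint v w p : dir v -> dir w -> L p -> p != 0 ->
  2 *: p = v + w -> dir p.
Proof.
move=> /diameter_directionP[_ _ Kv] /diameter_directionP[_ _ Kw] Lp p0 pE.
apply/diameter_directionP; split=> //.
have -> : delta *: p = delta *: w + 2^-1 *: (delta *: v - delta *: w).
  have -> : p = 2^-1 *: (v + w) by rewrite -pE scalerA mulVf ?scale1r.
  by apply/rowP => j; rewrite !mxE; field.
by apply: vK => //; lra.
Qed.

(** Choosing one supporting form at each member of [s] then provides, up to sign, a supporting form
    at every diameter direction. *)
Definition face_cover (s : seq 'rV[R]_d) :=
  (forall v, v \in s -> dir v) /\
  forall w, dir w -> exists2 v, v \in s & face w v \/ face (- w) v.

(** Inclusion of faces up to sign is transitive. *)
Lemma face_cover_replace s s' : face_cover s ->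
  (forall v, v \in s' -> dir v) ->
  (forall v, v \in s -> exists2 v', v' \in s' & face v v' \/ face (- v) v') ->
  face_cover s'.
Proof.
move=> [sD sC] s'D ss'; split=> // w /sC[v vs wv].
have [v' v's' vv'] := ss' v vs; exists v' => //.
case: wv => [wv|wv]; case: vv' => vv'; [left|right|right|left] => u /vv'.
- by move/wv.
- by move/(faceN _ _ wv).
- by move/wv.
- by move/(faceN _ _ wv); rewrite opprK.
Qed.

(* Minkowski's parity argument: two distinct directions [v <> - w] of the same
   class modulo [2 L] both lie in the face of their midpoint, which is again a
   diameter direction, so a face cover of least size meets each class at most
   once. *)
Lemma small_face_cover k : span_dim dir k ->
  exists2 s, face_cover s & (size s <= 2 ^ k - 1)%N.
Proof.
move=> [A [_ _ dirA]].
(* Restricting to the span bounds the number of parity classes by [2 ^ k] rather than [2 ^ d]. *)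
pose G := [set v | L v /\ (v <= A)%MS].
have dG : discrete_subgroup G.
  have [L0 LB [e e0 He] _] := HL; split.
  - by split=> //; rewrite sub0mx.
  - by move=> x y [Lx Ax] [Ly Ay]; split; [exact: LB | rewrite addmx_sub// eqmx_opp].
  - by exists e => // v [Lv _]; exact: He.
have [m [phi [mk phi_eq phi0]]] := parity_classes G dG k A (fun v => @proj2 _ _).
have dirG v : dir v -> G v.
  by move=> Dv; split; [case: Dv | exact: dirA].
have [s [sC smin]] : exists s, face_cover s /\
    forall s', face_cover s' -> (size s <= size s')%N.
  pose P n := `[< exists2 s, face_cover s & size s = n >].
  have exP : exists n, P n.
    have /finite_seqP[s sE] := finite_diameter_directions.
    have mem_s v : dir v <-> v \in s by rewrite sE.
    exists (size s); apply/asboolP; exists s => //; split=> [v /mem_s//|w /mem_s ws].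
    by exists w => //; left.
  have [n /asboolP[s sC ss] nmin] := ex_minnP exP.
  exists s; split=> // s' s'C.
  by rewrite ss; apply: nmin; apply/asboolP; exists s'.
exists s => //.
have sD : forall v, v \in s -> dir v by case: sC.
have us : uniq s.
  rewrite -[uniq s]negbK; apply/negP; rewrite -ltn_size_undup ltnNge => /negP; apply.
  apply: smin; apply: face_cover_replace sC _ _ => v; rewrite ?mem_undup//.
    exact: sD.
  by move=> vs; exists v; rewrite ?mem_undup//; left.
have phi_inj : {in s &, injective phi}.
  move=> v w vs ws vw; apply/eqP; apply: contraPT (leqnn (size s)) => vw0.
  have s0 : (0 < size s)%N by case: (s) vs.
  apply/negP; rewrite -ltnNge.
  (* Here the midpoint would be 0; but covers are taken up to sign, so [w] can simply be dropped. *)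
  have [wv|wv] := eqVneq w (- v).
    apply: (@leq_ltn_trans (size (rem w s))); last by rewrite size_rem// prednK.
    apply: smin; apply: face_cover_replace sC _ _ => x.
      by move=> /mem_rem /sD.
    move=> xs; have [->|xw] := eqVneq x w.
      exists v; first by rewrite mem_rem_uniq// !inE vw0.
      by right; rewrite wv opprK.
    by exists x; [rewrite mem_rem_uniq// !inE xw | left].
  have [q [[Lq _] vwq]] := phi_eq v w (dirG _ (sD _ vs)) (dirG _ (sD _ ws)) vw.
  (* As [v - w] is twice [q], this is the midpoint of [v] and [w]. *)
  pose p := w + q.
  have pE : 2 *: p = v + w.
    rewrite /p scalerDr -vwq (_ : 2 *: w = w + w); first by rewrite addrACA subrr addr0 addrC.
    by rewrite scaler_nat mulr2n.
  have Lp : L p by apply: (subgroupD _ (lattice_discrete _ HL)) => //; case: (sD _ ws).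
  have p0 : p != 0.
    apply: contraNneq wv => p0; move/eqP: pE; rewrite p0 scaler0 eq_sym addr_eq0.
    by move=> /eqP ->; rewrite opprK.
  have Dp := diameter_direction_midpoint v w p (sD _ vs) (sD _ ws) Lp p0 pE.
  have ws' : w \in rem v s by rewrite mem_rem_uniq// !inE eq_sym vw0.
  (* Trading both [v] and [w] for [p] shortens the cover by one. *)
  apply: (@leq_ltn_trans (size (p :: rem w (rem v s)))); last first.
    have : (0 < size (rem v s))%N by case: (rem v s) ws'.
    by rewrite /= (size_rem ws') (size_rem vs); case: (size s) => [|[|n]].
  apply: smin; apply: face_cover_replace sC _ _ => x.
    by rewrite inE => /orP[/eqP->//|/mem_rem /mem_rem /sD].
  move=> xs; have [->|xv] := eqVneq x v.
    exists p; [exact: mem_head | left].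
    exact: face_midpoint (sD _ vs) (sD _ ws) pE.
  have [->|xw] := eqVneq x w.
    exists p; [exact: mem_head | left].
    by apply: face_midpoint (sD _ ws) (sD _ vs) _; rewrite addrC.
  exists x; last by left.
  by rewrite inE mem_rem_uniq ?rem_uniq// inE xw mem_rem_uniq// inE xv xs orbT.
rewrite -(size_map phi) (leq_trans (n := 2 ^ m - 1))//; last first.
  by rewrite leq_sub2r// leq_pexp2l.
have /card_uniqP <- : uniq (map phi s) by rewrite map_inj_in_uniq.
(* The empty set codes the class of [2 G], which contains no diameter direction; this saves one
   class. *)
have -> : (2 ^ m - 1 = #|predC1 (finset.set0 : {set 'I_m})|)%N.
  by rewrite cardC1 -cardsT -powersetT card_powerset cardsT card_ord subn1.
apply/subset_leq_card/fintype.subsetP => _ /mapP[v vs ->]; rewrite inE.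
apply/eqP => pv0; have [q [[Lq _] vq]] := phi0 v (dirG _ (sD _ vs)) pv0.
by have := diameter_direction_half v q Lq vq; apply; exact: sD.
Qed.

End DiameterDirections.

(** * Completeness and the description of the body by slabs *)

Section Completeness.
Context {R : realType} {d : nat}.
Implicit Types (u v w x y z : 'rV[R]_d).

Definition thickening (C : set 'rV[R]_d) (e : R) : set 'rV[R]_d :=
  [set x | exists2 c, C c & `|x - c| <= e].

Lemma subset_thickening C e : 0 <= e -> C `<=` thickening C e.
Proof. by move=> e0 x Cx; exists x; rewrite // subrr normr0. Qed.

Lemma thickening_compact C e : compact C -> compact (thickening C e).
Proof.
move=> cC; rewrite (_ : thickening C e =
  [set x + y | x in C & y in [set y : 'rV[R]_d | `|y| <= e]]).
  apply: compact_add => //; apply: bounded_closed_compact.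
    exists e; split; first exact: num_real.
    by move=> M eM y /= ye; rewrite (le_trans ye)// ltW.
  apply: (@closed_comp _ _ (@Num.norm _ 'rV[R]_d) [set y : R | y <= e]).
    by move=> x _; exact: norm_continuous.
  exact: closed_le.
apply/seteqP; split=> [x [c Cc xc]|_ [x Cx [y ye <-]]].
  by exists c => //; exists (x - c) => //; rewrite addrC subrK.
by exists x => //; rewrite addrAC subrr add0r.
Qed.

Lemma thickening_convex C e : convex_set C -> convex_set (thickening C e).
Proof.
move=> vC x y t [c Cc xc] [c' Cc' yc'] t01; exists (c + t *: (c' - c)).
  exact: vC.
have -> : x + t *: (y - x) - (c + t *: (c' - c)) = (1 - t) *: (x - c) + t *: (y - c').
  by apply/rowP => j; rewrite !mxE; ring.
have /andP[t0 t1] := t01; have t1' : 0 <= 1 - t by rewrite subr_ge0.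
apply: le_trans (ler_normD _ _) _; rewrite !normrZ !ger0_norm//.
by have := ler_wpM2l t0 yc'; have := ler_wpM2l t1' xc; lra.
Qed.

Lemma small_radius (T : eqType) (s : seq T) (Q : T -> R -> Prop) :
  (forall (x : T) e e', Q x e -> 0 < e' -> e' <= e -> Q x e') ->
  (forall x : T, x \in s -> exists2 e, 0 < e & Q x e) ->
  exists2 e, 0 < e & forall x : T, x \in s -> Q x e.
Proof.
move=> Qle; elim: s => [_|x s IH sQ]; first by exists 1.
have [|e e0 He] := IH; first by move=> y ys; apply: sQ; rewrite inE ys orbT.
have [e' e'0 He'] := sQ x (mem_head _ _).
exists (Num.min e e'); first by rewrite lt_min e0.
have m0 : 0 < Num.min e e' by rewrite lt_min e0.
move=> y; rewrite inE => /orP[/eqP ->|ys].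
  by apply: Qle He' _ _ => //; rewrite ge_min lexx orbT.
by apply: Qle (He y ys) _ _ => //; rewrite ge_min lexx.
Qed.

(** Walk inside [P] from a point of [C] to one outside, in steps of length at most [e]; the first
    point that leaves [C] is close to its predecessor. *)
Lemma thickening_new_point (C P : set 'rV[R]_d) e : convex_set P -> C `<=` P ->
  C !=set0 -> ~ (P `<=` C) -> 0 < e -> exists x, [/\ P x, thickening C e x & ~ C x].
Proof.
move=> vP CP [c Cc] PC e0.
have [y Py Cy] : exists2 y, P y & ~ C y.
  by apply: contrapT => h; apply: PC => y Py; apply: contrapT => Cy; apply: h; exists y.
pose N := (Num.truncn (`|y - c| / e)).+1.
pose z (i : nat) := c + (i%:R / N%:R) *: (y - c).
have N0 : 0 < N%:R :> R by rewrite ltr0n.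
have zP i : (i <= N)%N -> P (z i).
  move=> iN; apply: vP => //; first exact: CP.
  by rewrite divr_ge0//= ler_pdivrMr// mul1r ler_nat.
have exC : exists i, ~~ `[< C (z i) >].
  by exists N; apply/asboolPn; rewrite /z divff ?gt_eqF// scale1r addrC subrK.
have [i /asboolPn Ci imin] := ex_minnP exC.
have iN : (i <= N)%N.
  by apply: imin; apply/asboolPn; rewrite /z divff ?gt_eqF// scale1r addrC subrK.
case: i => [|i] in Ci imin iN *.
  by case: Ci; rewrite /z mul0r scale0r addr0.
exists (z i.+1); split=> //; first exact: zP.
exists (z i).
  by apply: contrapT => /asboolPn /imin; rewrite ltnn.
rewrite /z opprD addrACA subrr add0r -scalerBl -mulrBl -natr1 addrAC subrr add0r div1r.
rewrite normrZ ger0_norm ?invr_ge0 ?(ltW N0)// mulrC ler_pdivrMr// mulrC.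
by rewrite -ler_pdivrMr// ltW// truncnS_gt.
Qed.

Variables (L C : set 'rV[R]_d).
Hypotheses (HL : is_lattice L) (bC : convex_body C) (d0 : (0 < d)%N).

Local Notation delta := (lattice_diam L C).
Local Notation K := (difference_body C).
Local Notation dir := (diameter_direction L C).

Let cC : compact C. Proof. by case: bC. Qed.
Let vC : convex_set C. Proof. by case: bC => _ []. Qed.
Let delta0 : 0 < delta. Proof. exact: lattice_diam_gt0. Qed.
Let C0 : C !=set0.
Proof. by have [_ [_ [x /interior_subset Cx]]] := bC; exists x. Qed.
Let vK : convex_set K. Proof. exact: difference_body_convex. Qed.
Let K0 : K 0. Proof. by have [x Cx] := C0; exists x, x; rewrite subrr. Qed.

(** Replace the ends of the segment by nearby points of [C] and shrink their difference by
    [delta / t], which is at most 1. *)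
Lemma diff_thickening e v x t : 0 < e -> 0 < delta <= t ->
  thickening C e x -> thickening C e (x + t *: v) ->
  exists2 z, K z & `|delta *: v - z| <= e + e.
Proof.
move=> e0 /andP[_ dt] [c Cc xc] [c' Cc' xc'].
have t0 : 0 < t by exact: lt_le_trans dt.
pose r := delta / t.
have r0 : 0 <= r by rewrite divr_ge0 ?ltW.
have r1 : r <= 1 by rewrite ler_pdivrMr// mul1r.
exists (r *: (c' - c)).
  rewrite -[r *: _]add0r -[c' - c]subr0; apply: vK => //; last by rewrite r0.
  by exists c', c.
have -> : delta *: v - r *: (c' - c) = r *: ((x + t *: v - c') - (x - c)).
  have -> : delta = r * t by rewrite divfK// gt_eqF.
  by apply/rowP => j; rewrite !mxE; ring.
rewrite normrZ ger0_norm//; apply: (@le_trans _ _ `|(x + t *: v - c') - (x - c)|).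
  by rewrite ler_piMl.
by apply: le_trans (ler_normB _ _) _; exact: lerD.
Qed.

(** A segment longer than [delta] in the thickening puts [delta *: v] within [2 * e] of [K]. Only
    finitely many [v] are candidates, and for each that is no diameter direction [delta *: v] has
    positive distance from the closed set [K]. *)
Lemma no_new_diameter_direction : exists2 e, 0 < e & forall v x t,
  L v -> v != 0 -> ~ dir v -> 0 <= t ->
  thickening C e x -> thickening C e (x + t *: v) -> t <= delta.
Proof.
have cK := difference_body_compact _ cC.
have [M M0 HM] := compact_norm_bound _ cK.
(* The radius will be at most 1, so a candidate satisfies [delta * |v| <= M + 2]. *)
have /finite_seqP[s sE] :=
  finite_bounded _ (lattice_discrete _ HL) ((M + 2) / delta).
have mem_s v : (L v /\ `|v| <= (M + 2) / delta) <-> v \in s.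
  by have := congr1 (fun A => A v) sE => /= ->.
pose Q v (e : R) := L v -> v != 0 -> ~ dir v ->
  forall z, K z -> e + e < `|delta *: v - z|.
have [||e e0 He] := @small_radius _ s Q.
- move=> v e e' Qe e'0 e'e Lv v0 Dv z Kz.
  by have := Qe Lv v0 Dv z Kz; lra.
- move=> v _; have [[Lv v0 Dv]|h] := pselect [/\ L v, v != 0 & ~ dir v]; last first.
    by exists 1 => // Lv v0 Dv; case: h.
  have Kv : (~` K) (delta *: v).
    by move=> Kv; apply: Dv; apply/(diameter_directionP _ _ bC).
  have : nbhs (delta *: v) (~` K).
    apply: open_nbhs_nbhs; split=> //; apply: closed_openC.
    exact: (compact_closed (@norm_hausdorff _ _) cK).
  move=> /nbhs_ballP[e /= e0 eK]; exists (e / 3); first by rewrite divr_gt0.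
  move=> _ _ _ z Kz; rewrite ltNge; apply/negP => ze.
  apply: (eK z) => //; rewrite -ball_normE /=.
  by apply: le_lt_trans ze _; lra.
exists (Num.min e 1); first by rewrite lt_min e0 ltr01.
set e1 := Num.min e 1.
have e10 : 0 < e1 by rewrite lt_min e0 ltr01.
have e1e : e1 <= e by rewrite ge_min lexx.
have e11 : e1 <= 1 by rewrite ge_min lexx orbT.
move=> v x t Lv v0 Dv t0 tx txv; rewrite leNgt; apply/negP => dt.
have [|z Kz zv] := diff_thickening e1 v x t e10 _ tx txv; first by rewrite delta0 ltW.
have vs : v \in s.
  apply/mem_s; split=> //; rewrite ler_pdivlMr// mulrC.
  rewrite -[delta in leLHS]gtr0_norm// -normrZ -[delta *: v](subrK z).
  by apply: le_trans (ler_normD _ _) _; have := HM _ Kz; lra.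
by have := He v vs Lv v0 Dv z Kz; lra.
Qed.

(** Otherwise a thin thickening of [C], cut by [P], is a larger body of the same diameter: [P]
    controls the diameter directions, the thickening all others. *)
Lemma lattice_complete_maximal (P : set 'rV[R]_d) :
  lattice_complete L C -> closed P -> convex_set P -> C `<=` P ->
  (forall v x t, dir v -> 0 <= t -> P x -> P (x + t *: v) -> t <= delta) ->
  P = C.
Proof.
move=> compl clP vP CP HP; apply/seteqP; split=> //; apply: contrapT => PC.
have [e e0 He] := no_new_diameter_direction.
have [x [Px tx Cx]] := thickening_new_point C P e vP CP C0 PC e0.
pose C' := thickening C e `&` P.
have CC' : C `<=` C'.
  by move=> y Cy; split; [exact: subset_thickening (ltW e0) _ Cy | exact: CP].
have bC' : convex_body C'.
  split; first by apply: compact_closedI => //; exact: thickening_compact.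
  split.
    move=> y z t [ty Py] [tz Pz] t01; split; last exact: vP.
    exact: thickening_convex.
  by have [_ [_ [y Cy]]] := bC; exists y; exact: interiorS Cy.
apply: (compl C' bC' CC'); first by move=> C'C; apply: Cx; rewrite -C'C.
apply/eqP; rewrite eq_le; apply/andP; split.
  apply: lattice_diam_le => //; first by have [y Cy] := C0; exists y; exact: CC'.
  move=> v y t Lv v0 t0 [ty Py] [tyv Pyv].
  have [Dv|Dv] := pselect (dir v); first exact: HP Dv t0 Py Pyv.
  exact: He Lv v0 Dv t0 ty tyv.
apply: lattice_diam_le => // v y t Lv v0 t0 Cy Cyv.
exact: (lattice_diam_ge _ HL _ v y _ bC' Lv v0 t0 (CC' _ Cy) (CC' _ Cyv)).
Qed.

(** Each member of a small face cover contributes the slab of one supporting form, and [C] equals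
    the intersection of the slabs by maximality. *)
Lemma lattice_complete_polyhedron k : lattice_complete L C -> span_dim dir k ->
  exists m (n : 'I_m * bool -> 'rV[R]_d) (b : 'I_m * bool -> R),
    [/\ (m <= 2 ^ k - 1)%N, forall i, n i != 0 & C = polyhedron _ n b].
Proof.
move=> compl /(small_face_cover _ _ HL bC d0)[s [sD sC] sk].
have tnthD (i : 'I_(size s)) : dir s`_i by apply: sD; exact: mem_nth.
have /choice[u Hu] (i : 'I_(size s)) :
    exists u, u != 0 /\ supports L C u s`_i.
  by have [u u0 us] := exists_supports _ _ HL bC d0 _ (tnthD i); exists u.
have /choice[a Ha] (i : 'I_(size s)) :
    exists a, C a /\ C (a + delta *: s`_i).
  have [_ [_ [a aC]]] := tnthD i; exists a.
  by split; apply: aC; [exact: segment_left | exact: segment_right].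
(* The flag chooses the side of the slab: the upper one passes through the end of a diameter, the
   lower one through its start. *)
pose n (j : 'I_(size s) * bool) := if j.2 then u j.1 else - u j.1.
pose b (j : 'I_(size s) * bool) :=
  if j.2 then dotv (u j.1) (a j.1 + delta *: s`_j.1) else - dotv (u j.1) (a j.1).
exists (size s), n, b; split=> // [[i []]|]; rewrite /n ?oppr_eq0; try by case: (Hu i).
apply/esym; apply: lattice_complete_maximal => //.
- exact: closed_polyhedron.
- exact: polyhedron_convex.
- move=> x Cx [i []]; rewrite /n /b /=; have [_ ui] := Hu i; have [Ca Cas] := Ha i.
    have /ui : K (x - a i) by exists x, (a i).
    by rewrite dotvBr dotvDr; lra.
  have /ui : K (a i + delta *: s`_i - x) by exists (a i + delta *: s`_i), x.
  by rewrite dotvBr dotvDr dotvNl; lra.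
move=> v x t Dv t0 Px Pxv.
have [w ws wv] := sC v Dv; have wi : (index w s < size s)%N by rewrite index_mem.
pose i := Ordinal wi; have ui : s`_i = w by rewrite /= nth_index.
have [u0 us] := Hu i; rewrite ui in us.
have := Px (i, true); have := Px (i, false).
have := Pxv (i, true); have := Pxv (i, false).
rewrite /n /b /= -/(nat_of_ord i) ui !dotvNl !dotvDr !dotvZr => h1 h2 h3 h4.
(* The form is maximal over [K] at both [delta *: w] and [delta *: y], so the slab also has width
   [delta] when measured along [y]. *)
have width y : face L C y w -> dir y ->
    0 < dotv (u i) y /\ delta * dotv (u i) w = delta * dotv (u i) y.
  move=> /(_ _ us) uy Dy.
  have /(diameter_directionP _ _ bC)[_ _ Ky] := Dy.
  have /(diameter_directionP _ _ bC)[_ _ Kw] := sD w ws.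
  have := supports_gt0 _ _ bC _ _ u0 uy; rewrite dotvZr pmulr_rgt0// => y0.
  split=> //; rewrite -!dotvZr; apply/eqP; rewrite eq_le; apply/andP.
  by split; [exact: uy | exact: us].
case: wv => [/width /(_ Dv)|/width /(_ (diameter_directionN _ _ HL bC _ Dv))].
  move=> [v0 e]; rewrite e in h2 h4.
  by rewrite -(ler_pM2r v0); lra.
rewrite dotvNr => -[v0 e]; rewrite e in h2 h4.
by rewrite -(ler_pM2r v0); lra.
Qed.

End Completeness.

(** * Polytope property and facet count *)

Theorem theorem3p4 (R : realType) (d : nat) (L : set 'rV[R]_d)
    (C : set 'rV[R]_d) (k : nat) :
  is_lattice L -> convex_body C -> lattice_complete L C ->
  span_dim (diameter_direction L C) k ->
  is_polytope C /\
  exists (N : nat) (Fs : 'I_N -> set 'rV[R]_d),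
    (N <= 2 ^ k.+1 - 2)%N /\ (forall F, facet C F -> exists i, F = Fs i).
Proof.
move=> HL bC compl Ck; have [cC [vC [x0 /interior_subset Cx0]]] := bC.
(* In dimension 0 the body is a point, and it has no facet because a facet normal is nonzero. *)
have [d0|d0] := posnP d.
  move: L C HL bC compl Ck cC vC x0 Cx0; rewrite d0 => {}L {}C _ _ _ _ _ _ x0 Cx0.
  have V0 (x y : 'rV[R]_0) : x = y by apply/rowP => -[].
  split.
    have -> : C = hull 'I_1 (fun=> 0).
      apply/seteqP; split=> x _; last by rewrite (V0 x x0).
      by rewrite (V0 x 0); exact: (hull_point _ (fun=> 0) 0).
    exact: is_polytope_hull.
  exists 0%N, (fun=> set0); split=> // F [u [b [/eqP u0 _ _ _]]].
  by case: u0; exact: V0.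
have [m [n [b [mk n0 CE]]]] := lattice_complete_polyhedron L C HL bC d0 k compl Ck.
have [M M0 HM] := compact_norm_bound _ cC.
split.
  rewrite CE; apply: (bounded_polyhedron_polytope _ _ _ M); rewrite -CE //.
  by exists x0.
exists #|{: 'I_m * bool}|, (fun i => [set x | C x /\ dotv (n (enum_val i)) x = b (enum_val i)]).
split.
  (* Two sides for each of at most [2 ^ k - 1] slabs. *)
  by rewrite card_prod card_ord card_bool expnS; lia.
move=> F; rewrite {1}CE => /(facet_polyhedron _ _ _ _ n0)[i ->].
by exists (enum_rank i); rewrite enum_rankK CE.
Qed.
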